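(* Let $A$ be a left-noetherian ring that satisfies condition (AC), and let $M$ be a finitely generated left $A$-module. If $\operatorname{Ext}_A^{i}(M,M)=0$ for all $i\gg 0$ and $\operatorname{Ext}_A^{i}(M,A)=0$ for all $i\geq 1$, then $M$ is projective.
   Context: A left-noetherian ring $A$ satisfies condition (AC) if for every finitely generated left $A$-module $M$ there exists an integer $b_M\geq 0$ such that for every finitely generated left $A$-module $N$ one has: if $\operatorname{Ext}_A^{i}(M,N)=0$ for all $i\gg 0$, then $\operatorname{Ext}_A^{i}(M,N)=0$ for all $i>b_M$. Rings are associative with unit. *)

(* Defs.v *)
From HB Require Import structures.
From mathcomp Require Import all_boot all_algebra.
From mathcomp Require Import boolp functions.

Set Implicit Arguments.
Unset Strict Implicit.
Unset Printing Implicit Defensive.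

Import GRing.Theory.
Local Open Scope ring_scope.

(* Rings are [pzRingType]s, so that the zero ring is allowed; a left A-module
   is an [lmodType A], and A as a left module over itself is [A^o]. *)

Definition left_noetherian (A : pzRingType) : Prop :=
  forall I : nat -> {pred A^o},
    (forall n, submod_closed (I n)) ->
    (forall n, {subset I n <= I n.+1}) ->
    exists N, forall n, (N <= n)%N -> I n =i I N.

Definition finitely_generated (A : pzRingType) (M : lmodType A) : Prop :=
  exists n (v : 'I_n -> M),
    forall x, exists c : 'I_n -> A, x = \sum_(i < n) c i *: v i.

Definition projective (A : pzRingType) (P : lmodType A) : Prop :=
  forall (X Y : lmodType A) (p : {linear X -> Y}) (u : {linear P -> Y}),
    (forall y, exists x, p x = y) ->
    exists h : {linear P -> X}, forall z, p (h z) = u z.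

Section HomGroup.
Variables (A : pzRingType) (P N : lmodType A).

Definition LinHom : Type := {linear P -> N}.

HB.instance Definition _ := gen_eqMixin LinHom.
HB.instance Definition _ := gen_choiceMixin LinHom.

Lemma LinHomP (f g : LinHom) : (forall x, f x = g x) -> f = g.
Proof.
case: f g => [f [[a1] [m1]]] [g [[a2] [m2]]] /= fg.
have {}fg : f = g by apply/funext.
subst g; congr GRing.Linear.Pack.
by congr GRing.Linear.Class; congr (_ _); apply: Prop_irrelevance.
Qed.

Definition LinHom_zero : LinHom := (\0 : {linear P -> N}).
Definition LinHom_opp (f : LinHom) : LinHom :=
  (\- (f : {linear P -> N}) : {linear P -> N}).
Definition LinHom_add (f g : LinHom) : LinHom :=
  ((f : {linear P -> N}) \+ (g : {linear P -> N}) : {linear P -> N}).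

Fact LinHom_addA : associative LinHom_add.
Proof. by move=> f g h; apply: LinHomP => x; apply: addrA. Qed.
Fact LinHom_addC : commutative LinHom_add.
Proof. by move=> f g; apply: LinHomP => x; apply: addrC. Qed.
Fact LinHom_add0 : left_id LinHom_zero LinHom_add.
Proof. by move=> f; apply: LinHomP => x; apply: add0r. Qed.
Fact LinHom_addN : left_inverse LinHom_zero LinHom_opp LinHom_add.
Proof. by move=> f; apply: LinHomP => x; apply: addNr. Qed.

HB.instance Definition _ :=
  GRing.isZmodule.Build LinHom LinHom_addA LinHom_addC LinHom_add0 LinHom_addN.

Lemma LinHom0E x : (0 : LinHom) x = 0. Proof. by []. Qed.
Lemma LinHomNE (f : LinHom) x : (- f) x = - f x. Proof. by []. Qed.
Lemma LinHomDE (f g : LinHom) x : (f + g) x = f x + g x. Proof. by []. Qed.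
Lemma LinHomBE (f g : LinHom) x : (f - g) x = f x - g x. Proof. by []. Qed.

End HomGroup.

Record projective_resolution (A : pzRingType) (M : lmodType A) : Type := {
  res_mod : nat -> lmodType A;
  res_d : forall n, {linear res_mod n.+1 -> res_mod n};
  res_aug : {linear res_mod 0%N -> M};
  res_proj : forall n, projective (res_mod n);
  res_aug_surj : forall x, exists y, res_aug y = x;
  res_exact0 : forall x, res_aug x = 0 <-> exists y, res_d 0%N y = x;
  res_exactS : forall n x, res_d n x = 0 <-> exists y, res_d n.+1 y = x
}.

Section Cohomology.
Variables (A : pzRingType) (M : lmodType A) (P : projective_resolution M).
Variable N : lmodType A.

Definition cochain (n : nat) : zmodType := LinHom (res_mod P n) N.

Definition coboundary (n : nat) (f : cochain n) : cochain n.+1 :=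
  ((f : {linear res_mod P n -> N}) \o res_d P n : {linear _ -> _}).

Fact coboundary_is_zmod_morphism n : zmod_morphism (@coboundary n).
Proof. by move=> f g; apply: LinHomP. Qed.

HB.instance Definition _ n :=
  GRing.isZmodMorphism.Build (cochain n) (cochain n.+1) (@coboundary n)
    (@coboundary_is_zmod_morphism n).

Definition is_cocycle (n : nat) : {pred cochain n} :=
  fun f => coboundary f == 0.

Fact is_cocycle_closed n : zmod_closed (@is_cocycle n).
Proof.
split=> [|f g]; rewrite !unfold_in; first by rewrite raddf0.
by move=> /eqP f0 /eqP g0; rewrite coboundary_is_zmod_morphism f0 g0 subr0.
Qed.

HB.instance Definition _ n :=
  GRing.isZmodClosed.Build (cochain n) (@is_cocycle n) (@is_cocycle_closed n).

Record cocycle (n : nat) : Type :=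
  Cocycle { cocycle_val : cochain n; cocycleP : cocycle_val \in @is_cocycle n }.

HB.instance Definition _ n := [isSub for @cocycle_val n].
HB.instance Definition _ n := [Choice of cocycle n by <:].
HB.instance Definition _ n := [SubChoice_isSubZmodule of cocycle n by <:].

(* The complex Hom(P, N) is zero in degree -1, so that 0 is the only
   coboundary of degree 0. *)
Definition is_coboundary (n : nat) : {pred cocycle n} :=
  match n return {pred cocycle n} with
  | 0 => fun f => f == 0
  | m.+1 => fun f => `[< exists g : cochain m, val f = coboundary g >]
  end.

Fact is_coboundary_closed n : zmod_closed (@is_coboundary n).
Proof.
case: n => [|n]; split=> [|f g]; rewrite !unfold_in /=.
- exact: eqxx.
- by move=> /eqP -> /eqP ->; rewrite subr0.
- by apply/asboolP; exists 0; rewrite raddf0.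
move=> /asboolP[a fa] /asboolP[b gb].
by apply/asboolP; exists (a - b); rewrite coboundary_is_zmod_morphism -fa -gb.
Qed.

HB.instance Definition _ n :=
  GRing.isZmodClosed.Build (cocycle n) (@is_coboundary n)
    (@is_coboundary_closed n).

Definition Ext_of (n : nat) : zmodType := Quotient.quot (@is_coboundary n).

End Cohomology.

Section FreeModule.
Variables (A : pzRingType) (T : choiceType).

Definition fin_supp : {pred T -> A^o} :=
  fun f => `[< exists s : seq T, forall x, f x != 0 -> x \in s >].

Fact fin_supp_closed : submod_closed fin_supp.
Proof.
split=> [|a f g]; rewrite !unfold_in.
  by apply/asboolP; exists [::] => x; rewrite eqxx.
move=> /asboolP[s fs] /asboolP[t gt]; apply/asboolP; exists (s ++ t) => x.
rewrite mem_cat; have [fx0|/fs->//] := eqVneq (f x) 0.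
have [gx0|/gt->] := eqVneq (g x) 0; last by rewrite orbT.
by rewrite fctE /= -[(a *: f) x]/(a *: f x) fx0 gx0 scaler0 addr0 eqxx.
Qed.

HB.instance Definition _ :=
  GRing.isSubmodClosed.Build A (T -> A^o) fin_supp fin_supp_closed.

Record free_module : Type :=
  FreeModule { free_val : T -> A^o; free_valP : free_val \in fin_supp }.

HB.instance Definition _ := [isSub for free_val].
HB.instance Definition _ := [Choice of free_module by <:].
HB.instance Definition _ := [SubChoice_isSubLmodule of free_module by <:].


Fact free_supp_ex (f : free_module) : exists s, uniq s /\
  forall x, free_val f x != 0 -> x \in s.
Proof.
have := free_valP f; rewrite unfold_in => /asboolP[s fs].
by exists (undup s); split; [exact: undup_uniq | move=> x /fs; rewrite mem_undup].
Qed.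

Definition free_supp (f : free_module) : seq T := projT1 (cid (free_supp_ex f)).

Lemma free_supp_uniq (f : free_module) : uniq (free_supp f).
Proof. by rewrite /free_supp; case: cid => s /= []. Qed.

Lemma mem_free_supp (f : free_module) x :
  free_val f x != 0 -> x \in free_supp f.
Proof. by rewrite /free_supp; case: cid => s /= [_]; apply. Qed.

Fact delta_fin_supp (t : T) : (fun x => (x == t)%:R : A^o) \in fin_supp.
Proof.
rewrite unfold_in; apply/asboolP; exists [:: t] => x.
by rewrite inE; case: (x == t) => //; rewrite eqxx.
Qed.

Definition delta (t : T) : free_module := FreeModule (delta_fin_supp t).

Variables (M : lmodType A) (v : T -> M).

Definition free_eval (f : free_module) : M :=
  \sum_(x <- free_supp f) (free_val f x : A) *: v x.

Lemma free_evalE (f : free_module) (s : seq T) :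
  uniq s -> (forall x, free_val f x != 0 -> x \in s) ->
  free_eval f = \sum_(x <- s) (free_val f x : A) *: v x.
Proof.
move=> us fs; rewrite /free_eval.
pose Q x := free_val f x != 0.
have drop r : \sum_(x <- r) (free_val f x : A) *: v x =
              \sum_(x <- [seq x <- r | Q x]) (free_val f x : A) *: v x.
  rewrite big_filter [RHS]big_mkcond /=; apply: eq_bigr => x _.
  by rewrite /Q; case: eqP => [->|//]; rewrite scale0r.
rewrite drop [RHS]drop; apply: perm_big; apply: uniq_perm.
- by rewrite filter_uniq ?free_supp_uniq.
- by rewrite filter_uniq.
- move=> x; rewrite !mem_filter; case Qx: (Q x) => //=.
  by rewrite (mem_free_supp Qx) (fs x Qx).
Qed.

Fact free_eval_is_linear : linear free_eval.
Proof.
move=> a f g; pose s := undup (free_supp f ++ free_supp g).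
have fs x : free_val f x != 0 -> x \in s.
  move=> /mem_free_supp xs.
  by rewrite mem_undup mem_cat xs.
have gs x : free_val g x != 0 -> x \in s.
  move=> /mem_free_supp xs.
  by rewrite mem_undup mem_cat xs orbT.
have us : uniq s := undup_uniq _.
have hs x : free_val (a *: f + g) x != 0 -> x \in s.
  have [fx0|/fs//] := eqVneq (free_val f x) 0.
  have [gx0|/gs//] := eqVneq (free_val g x) 0.
  rewrite (_ : free_val _ x = a * free_val f x + free_val g x :> A) //.
  by rewrite fx0 gx0 mulr0 addr0 eqxx.
rewrite (free_evalE us fs) (free_evalE us gs) (free_evalE us hs).
rewrite scaler_sumr -big_split /=; apply: eq_bigr => x _.
by rewrite scalerA -scalerDl; congr (_ *: _).
Qed.

HB.instance Definition _ :=
  GRing.isLinear.Build A free_module M *:%R free_eval free_eval_is_linear.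

Lemma free_eval_delta (t : T) : free_eval (delta t) = v t.
Proof.
rewrite (@free_evalE _ [:: t]) //; first by rewrite big_seq1 /= eqxx scale1r.
by move=> x /=; rewrite inE; case: (x == t) => //; rewrite eqxx.
Qed.

End FreeModule.

Lemma free_decomp (A : pzRingType) (T : choiceType) (f : free_module A T) :
  f = \sum_(x <- free_supp f) (free_val f x : A) *: delta A x.
Proof.
apply: val_inj; apply/funext => t.
have -> : \val (\sum_(x <- free_supp f) (free_val f x : A) *: delta A x) t =
          \sum_(x <- free_supp f) free_val f x * (t == x)%:R :> A.
  elim: (free_supp f) => [|x s IH]; first by rewrite !big_nil.
  by rewrite !big_cons raddfD /= -IH.
have [ts|ts] := boolP (t \in free_supp f).
  rewrite (bigD1_seq t) ?free_supp_uniq //= eqxx mulr1 big1 ?addr0 // => x.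
  by rewrite eq_sym => /negPf ->; rewrite mulr0.
rewrite big_seq big1 => [|x xs]; last first.
  by case: eqP ts xs => [<- /negPf->//|_ _ _]; rewrite mulr0.
by apply/eqP; apply: contraNT ts => /mem_free_supp.
Qed.

Lemma free_module_projective (A : pzRingType) (T : choiceType) :
  projective (free_module A T).
Proof.
move=> X Y p u psurj.
pose w t := projT1 (cid (psurj (u (delta A t)))).
have pw t : p (w t) = u (delta A t) by rewrite /w; case: cid.
exists (free_eval w) => f.
rewrite [in RHS](free_decomp f) /= /free_eval !linear_sum; apply: eq_bigr => x _.
by rewrite !linearZ pw.
Qed.

Section Kernel.
Variables (A : pzRingType) (V W : lmodType A) (f : {linear V -> W}).

Definition in_kernel : {pred V} := fun x => f x == 0.

Fact in_kernel_closed : submod_closed in_kernel.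
Proof.
split=> [|a x y]; rewrite !unfold_in ?linear0 //.
by move=> /eqP fx /eqP fy; rewrite linearP fx fy scaler0 addr0.
Qed.

HB.instance Definition _ :=
  GRing.isSubmodClosed.Build A V in_kernel in_kernel_closed.

Record kernel : Type :=
  Kernel { kernel_val : V; kernelP : kernel_val \in in_kernel }.

HB.instance Definition _ := [isSub for kernel_val].
HB.instance Definition _ := [Choice of kernel by <:].
HB.instance Definition _ := [SubChoice_isSubLmodule of kernel by <:].

Definition kernel_incl : {linear kernel -> V} := (\val : kernel -> V).

End Kernel.

(* The free module on the underlying set of M, with its canonical surjection
   onto M, yields the standard free resolution of M: each syzygy is covered by
   the free module on its underlying set. *)
Section StandardResolution.
Variables (A : pzRingType) (M : lmodType A).

Definition free_cover (K : lmodType A) : {linear free_module A K -> K} :=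
  @free_eval A K K id.

Lemma free_cover_surj (K : lmodType A) x : exists y, free_cover K y = x.
Proof. by exists (delta A x); apply: free_eval_delta. Qed.

Fixpoint syzygy (n : nat) : lmodType A :=
  if n is m.+1 then kernel (free_cover (syzygy m)) else M.

Definition std_mod (n : nat) : lmodType A := free_module A (syzygy n).

Definition std_d (n : nat) : {linear std_mod n.+1 -> std_mod n} :=
  kernel_incl (free_cover (syzygy n)) \o free_cover (syzygy n.+1).

Lemma std_exact n x :
  free_cover (syzygy n) x = 0 <-> exists y, std_d n y = x.
Proof.
split=> [x0|[y <-]]; last by apply/eqP; apply: (kernelP (free_cover _ y)).
have xK : x \in in_kernel (free_cover (syzygy n)) by apply/eqP.
by have [y yE] := free_cover_surj (Kernel xK : syzygy n.+1); exists y;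
   rewrite /= yE.
Qed.

Lemma std_exactS n x : std_d n x = 0 <-> exists y, std_d n.+1 y = x.
Proof.
rewrite -std_exact; split=> [dx0|x0]; last by rewrite /= x0.
by apply: val_inj.
Qed.

Definition std_resolution : projective_resolution M :=
  @Build_projective_resolution A M std_mod std_d (free_cover M)
    (fun n => @free_module_projective A (syzygy n))
    (free_cover_surj (K:=M)) (@std_exact 0%N) std_exactS.

End StandardResolution.

(* Ext^n_A(M, N); by the comparison theorem any other projective resolution of
   M gives an isomorphic group. *)
Definition Ext (A : pzRingType) (n : nat) (M N : lmodType A) : zmodType :=
  Ext_of (std_resolution M) N n.

Definition Ext_vanishes (A : pzRingType) (n : nat) (M N : lmodType A) : Prop :=
  forall x : Ext n M N, x = 0.

Definition Ext_eventually_vanishes (A : pzRingType) (M N : lmodType A) : Prop :=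
  exists b : nat, forall i, (b < i)%N -> Ext_vanishes i M N.

Definition condition_AC (A : pzRingType) : Prop :=
  forall M : lmodType A, finitely_generated M ->
  exists b : nat,
  forall N : lmodType A, finitely_generated N ->
    Ext_eventually_vanishes M N ->
    forall i, (b < i)%N -> Ext_vanishes i M N.

(* Main.v *)
(** Since [Ext^i(M, F) = 0] for [i >= 1] and [F] finitely generated free,
    dimension shifting along [0 -> K -> F -> N -> 0] gives
    [Ext^i(M, N) = Ext^(i+1)(M, K)] for [i >= 1].  If [Ext^i(M, N)] vanishes for
    large [i], so does [Ext^i(M, N')] for every iterated syzygy [N'] of [N], and
    (AC) bounds the last nonzero degree by a number [b] depending on [M] only;
    shifting back from the [b]-th syzygy, [Ext^i(M, N) = 0] for all [i >= 1].
    For [N] the first syzygy of [M] and [i = 1] this splits [F -> M]. *)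

From HB Require Import structures.
Require Import Defs.
From mathcomp Require Import all_boot all_algebra.
From mathcomp Require Import boolp.

Set Implicit Arguments.
Unset Strict Implicit.
Unset Printing Implicit Defensive.

Import GRing.Theory.
Local Open Scope ring_scope.

(** * Finite generation over a left-noetherian ring *)

Section Span.
Variables (A : pzRingType) (V : lmodType A).

(** Recursive form, so that inductions on a generating list peel off one coefficient at a time. *)
Fixpoint span (l : seq V) (x : V) : Prop :=
  if l is y :: l' then exists a : A, span l' (x - a *: y) else x = 0.

Lemma span0 l : span l 0.
Proof. by elim: l => //= y l IH; exists 0; rewrite scale0r subr0. Qed.

Lemma span_linear l a x y : span l x -> span l y -> span l (a *: x + y).
Proof.
elim: l x y => [|z l IH] x y /=; first by move=> -> ->; rewrite scaler0 addr0.
move=> [b xb] [c yc]; exists (a * b + c).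
rewrite scalerDl -scalerA opprD addrACA -scalerBr.
exact: IH.
Qed.

Lemma span_head y l : span (y :: l) y.
Proof. by exists 1; rewrite scale1r subrr; apply: span0. Qed.

Lemma span_cons y l x : span l x -> span (y :: l) x.
Proof. by exists 0; rewrite scale0r subr0. Qed.

Lemma span_mem l y : y \in l -> span l y.
Proof.
elim: l => // z l IH; rewrite inE => /orP[/eqP->|/IH yl].
  exact: span_head.
exact: span_cons.
Qed.

Lemma span_cat l l' x y : span l y -> span l' (x - y) -> span (l ++ l') x.
Proof.
elim: l x y => [|z l IH] x y /=; first by move->; rewrite subr0.
move=> [a ly] l'y; exists a; apply: IH ly _.
by rewrite opprB addrA subrK.
Qed.

Lemma span_sumP l x :
  span l x <-> exists c : 'I_(size l) -> A, x = \sum_i c i *: l`_i.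
Proof.
elim: l x => [|y l IH] x /=.
  by split=> [->|[c ->]]; [exists (fun=> 0)|]; rewrite big_ord0.
split=> [[a /IH[c xc]]|[c ->]].
  exists (fun i => if unlift ord0 i is Some j then c j else a).
  rewrite big_ord_recl unlift_none /=.
  under eq_bigr do rewrite liftK.
  by rewrite -xc addrC subrK.
exists (c ord0); apply/IH; exists (fun i => c (lift ord0 i)).
by rewrite big_ord_recl /= addrAC subrr add0r.
Qed.

End Span.

Lemma span_map_inj (A : pzRingType) (V W : lmodType A) (f : {linear V -> W})
  l x : injective f -> span (map f l) (f x) -> span l x.
Proof.
move=> f_inj; elim: l x => [|y l IH] x /=.
  by move=> fx0; apply: f_inj; rewrite linear0.
by move=> [a ax]; exists a; apply: IH; rewrite linearB linearZ.
Qed.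

Lemma finitely_generatedP (A : pzRingType) (V : lmodType A) :
  finitely_generated V <-> exists l, forall x : V, span l x.
Proof.
split=> [[n [v vP]]|[l lP]].
  exists (codom v) => x; have [c ->] := vP x.
  apply: (big_ind (span (codom v))) => [|y z yP zP|i _]; first exact: span0.
    by rewrite -[y]scale1r; apply: span_linear.
  rewrite -[_ *: _]addr0; apply: span_linear; last exact: span0.
  by apply: span_mem; apply: codom_f.
by exists (size l), (fun i => l`_i) => x; apply/span_sumP.
Qed.

Definition fg_sub (A : pzRingType) (V : lmodType A) (S : V -> Prop) : Prop :=
  exists2 l, {in l, forall x, S x} & forall x, S x -> span l x.

(** If no finite list works, adjoining again and again an element outside the current span gives a
    strictly ascending chain of left ideals, the spans. *)
Lemma noetherian_ideal_fg (A : pzRingType) (I : A^o -> Prop) :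
  left_noetherian A -> fg_sub I.
Proof.
move=> hA; apply: contrapT => nfg.
(* The default [0] is never reached on lists in [I], by [nfg]. *)
pose step (l : seq A^o) := if pselect (exists2 x, I x & ~ span l x) is left e
  then projT1 (cid2 e) else 0.
have stepP l : {in l, forall x, I x} -> I (step l) /\ ~ span l (step l).
  move=> lI; rewrite /step; case: pselect => [e|ne]; first by case: cid2.
  case: nfg; exists l => // x Ix; apply: contrapT => nx.
  by case: ne; exists x.
pose fix l n : seq A^o := if n is m.+1 then step (l m) :: l m else [::].
have lI n : {in l n, forall x, I x}.
  elim: n => //= n IH x; rewrite inE => /orP[/eqP->|/IH//].
  exact: (stepP _ IH).1.
pose J n : {pred A^o} := fun x => `[< span (l n) x >].
have [||N /(_ N.+1 (leqnSn N)) JN] := hA J.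
- move=> n; split=> [|a x y]; rewrite !unfold_in; first by apply/asboolP/span0.
  by move=> /asboolP Jx /asboolP Jy; apply/asboolP/span_linear.
- move=> n x; rewrite !unfold_in => /asboolP Jx.
  by apply/asboolP; apply: span_cons.
(* The element added at stage [N] lies in the next span, which equals the [N]-th one. *)
apply: (stepP _ (lI N)).2; apply/asboolP.
have := JN (step (l N)); rewrite !unfold_in => <-.
by apply/asboolP; apply: span_head.
Qed.

(* Induction on the generators: the coefficients of [v] in elements of [S] form
   an ideal, and lifts of its generators reduce [S] to its intersection with the
   span of the remaining generators [g]. *)
Lemma noetherian_sub_fg (A : pzRingType) (V : lmodType A) (g : seq V)
    (S : V -> Prop) :
  left_noetherian A -> S 0 ->
  (forall a x y, S x -> S y -> S (a *: x + y)) ->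
  (forall x, S x -> span g x) -> fg_sub S.
Proof.
move=> hA; elim: g S => [|v g IH] S S0 SP Sg.
  by exists [::] => // x /Sg.
have [l2 l2S l2P] := IH (fun x => S x /\ span g x)
  (conj S0 (span0 g))
  (fun a x y Sx Sy => conj (SP a x y Sx.1 Sy.1) (span_linear a Sx.2 Sy.2))
  (fun x Sx => Sx.2).
pose I (a : A^o) := exists2 x, S x & span g (x - (a : A) *: v).
have [li liI liP] := @noetherian_ideal_fg A I hA.
have [l1 l1S l1P] : exists2 l1, {in l1, forall x, S x} &
    forall a, span li a -> exists2 x, span l1 x & span g (x - (a : A) *: v).
  elim: li liI {liP} => [|b li IHl] liI.
    exists [::] => // a ->; exists 0 => //.
    by rewrite scale0r subr0; apply: span0.
  have [|l1 l1S l1P] := IHl.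
    by move=> a al; apply: liI; rewrite inE al orbT.
  have [y Sy yb] := liI b (mem_head _ _).
  exists (y :: l1) => [x|a [c /l1P[x xl1 xa]]].
    by rewrite inE => /orP[/eqP->|/l1S].
  exists (c *: y + x).
    by exists c; rewrite addrAC subrr add0r.
  have -> : c *: y + x - (a : A) *: v =
      c *: (y - (b : A) *: v) + (x - (a - c *: b : A) *: v).
    by rewrite scalerBr scalerBl scalerA opprB addrACA addKr.
  exact: span_linear.
exists (l1 ++ l2) => [x|x Sx].
  by rewrite mem_cat => /orP[/l1S|/l2S[]].
have [a xa] := Sg x Sx.
(* [a] is a [v]-coefficient of both [x] and [y] modulo the span of [g], so [x - y] lies in that span
   and [l2] handles it. *)
have [|y yl1 ya] := l1P a; first by apply: liP; exists x.
have Sy : S y.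
  have clos (l : seq V) z : {in l, forall x, S x} -> span l z -> S z.
    elim: l z => [|w l IHl] z lS /=; first by move->.
    move=> [b zb]; rewrite -(subrK (b *: w) z) addrC; apply: SP.
      by apply: lS; rewrite mem_head.
    by apply: IHl zb => t tl; apply: lS; rewrite inE tl orbT.
  exact: clos yl1.
apply: (span_cat yl1); apply: l2P; split.
  by rewrite addrC -scaleN1r; apply: SP.
have -> : x - y = - 1 *: (y - a *: v) + (x - a *: v).
  by rewrite scaleN1r opprB [RHS]addrC addrA subrK.
exact: span_linear.
Qed.

Lemma noetherian_kernel_fg (A : pzRingType) (V W : lmodType A)
    (f : {linear V -> W}) :
  left_noetherian A -> finitely_generated V -> finitely_generated (kernel f).
Proof.
move=> hA /finitely_generatedP[g gP]; apply/finitely_generatedP.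
have [|a x y fx fy|//|l lK lP] :=
  @noetherian_sub_fg A V g (fun x => f x = 0) hA.
- exact: linear0.
- by rewrite linearP fx fy scaler0 addr0.
have [l' ll'] : exists l', l = map (kernel_incl f) l'.
  elim: l lK {lP} => [|x l IH] lK; first by exists [::].
  have [|l' ->] := IH; first by move=> y yl; apply: lK; rewrite inE yl orbT.
  have xK : x \in in_kernel f by apply/eqP/lK/mem_head.
  by exists (Kernel xK :: l').
exists l' => x; apply: (@span_map_inj _ _ _ (kernel_incl f)).
  exact: val_inj.
by rewrite -ll'; apply: lP; apply/eqP; apply: (kernelP x).
Qed.

(** * Vanishing of Ext along short exact sequences *)

Lemma quot_pi_eq0 (R : zmodType) (I : zmodClosed R) (x : R) :
  (\pi_(Quotient.quot I) x == 0)%qT = (x \in I).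
Proof. by rewrite -[x in RHS]subr0 Quotient.idealrBE pi_zeror. Qed.

Lemma kernel_factor (A : pzRingType) (U V W : lmodType A) (p : {linear V -> W})
    (f : {linear U -> V}) : (forall x, p (f x) = 0) ->
  exists g : {linear U -> kernel p}, forall x, f x = kernel_incl p (g x).
Proof.
move=> pf; pose g x := Kernel (introT eqP (pf x) : f x \in in_kernel p).
have g_lin : linear g by move=> a x y; apply: val_inj; rewrite /= linearP.
pose h : {linear U -> kernel p} :=
  HB.pack g (GRing.isLinear.Build A U (kernel p) *:%R g g_lin).
by exists h.
Qed.

Lemma kernel_inclP (A : pzRingType) (V W : lmodType A) (p : {linear V -> W})
  (k : kernel p) : p (kernel_incl p k) = 0.
Proof. exact/eqP/(kernelP k). Qed.

Lemma kernel_incl_inj (A : pzRingType) (V W : lmodType A)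
  (p : {linear V -> W}) : injective (kernel_incl p).
Proof. exact: val_inj. Qed.

Section ExtVanishing.
Variables (A : pzRingType) (M : lmodType A) (R : projective_resolution M).

Local Notation P := (res_mod R).
Local Notation d := (res_d R).
Local Notation aug := (res_aug R).

Definition Ext_of_vanishes n (N : lmodType A) : Prop :=
  forall x : Ext_of R N n, x = 0.

(** Trades classes in the quotient for maps out of the resolution, on which all diagram chases below
    operate. *)
Lemma Ext_of_vanishesP n (N : lmodType A) :
  Ext_of_vanishes n.+1 N <->
  forall f : {linear P n.+1 -> N}, (forall x, f (d n.+1 x) = 0) ->
    exists g : {linear P n -> N}, forall x, f x = g (d n x).
Proof.
split=> [E f fd|E x].
  have fc : (f : cochain R N n.+1) \in @is_cocycle _ _ _ _ _.
    by apply/eqP; apply: LinHomP => x; apply: fd.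
  have /eqP := E (\pi_(Ext_of R N n.+1) (Cocycle fc))%qT.
  rewrite quot_pi_eq0 unfold_in /= => /asboolP[g fg].
  by exists g => x; rewrite fg.
rewrite -[x]reprK; apply/eqP; rewrite quot_pi_eq0 unfold_in /=.
have /eqP xc := cocycleP (repr x).
have [y|g xg] := E (cocycle_val (repr x)).
  by have := congr1 (fun h : LinHom _ _ => h y) xc.
by apply/asboolP; exists g; apply: LinHomP.
Qed.

Lemma res_dd n x : d n (d n.+1 x) = 0.
Proof. by apply/res_exactS; exists x. Qed.

Lemma res_augd x : aug (d 0 x) = 0.
Proof. by apply/res_exact0; exists x. Qed.

Section ShortExact.
Variables (F N : lmodType A) (p : {linear F -> N}).
Hypothesis p_surj : forall y, exists x, p x = y.

Local Notation incl := (kernel_incl p).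

(** The middle term of [Ext^(n+1)(N) -> Ext^(n+2)(ker p) -> Ext^(n+2)(F)] vanishes with the outer
    ones. *)
Lemma Ext_of_vanishes_kernel n :
  Ext_of_vanishes n.+1 N -> Ext_of_vanishes n.+2 F ->
  Ext_of_vanishes n.+2 (kernel p).
Proof.
move=> /Ext_of_vanishesP EN /Ext_of_vanishesP EF.
apply/Ext_of_vanishesP => f fd.
have [x|g fg] := EF (incl \o f); first by rewrite /= fd.
have [x|h gh] := EN (p \o g).
  by rewrite /= -fg kernel_inclP.
(* Correcting [g] by the coboundary of a lift of [h] moves it into the kernel of [p] and keeps its
   own coboundary. *)
have [h' ph] := res_proj h p_surj.
have [x|k gk] := @kernel_factor _ _ _ _ p (g \- (h' \o d n)).
  by rewrite /= linearB ph -gh subrr.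
exists k => x; apply: kernel_incl_inj.
by rewrite -gk /= res_dd linear0 subr0; apply: fg.
Qed.

(** Same argument for [Ext^(n+1)(F) -> Ext^(n+1)(N) -> Ext^(n+2)(ker p)]. *)
Lemma Ext_of_vanishes_cokernel n :
  Ext_of_vanishes n.+2 (kernel p) -> Ext_of_vanishes n.+1 F ->
  Ext_of_vanishes n.+1 N.
Proof.
move=> /Ext_of_vanishesP EK /Ext_of_vanishesP EF.
apply/Ext_of_vanishesP => f fd.
have [f' pf] := res_proj f p_surj.
(* [c] represents the image of the class of [f] under the connecting map. *)
have [x|c fc] := @kernel_factor _ _ _ _ p (f' \o d n.+1).
  by rewrite /= pf fd.
have [x|k ck] := EK c.
  by apply: kernel_incl_inj; rewrite -fc linear0 /= res_dd linear0.
have [x|g fg] := EF (f' \- (incl \o k)).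
  have fx : f' (d n.+1 x) = incl (c x) by rewrite -fc.
  by rewrite /= fx ck subrr.
exists (p \o g) => x.
by rewrite /= -fg -pf linearB kernel_inclP subr0.
Qed.

End ShortExact.

(** The class of the extension [0 -> ker p -> F -> M -> 0] vanishes, so [p] has a linear section and
    [M] is a retract of [F]. *)
Lemma projective_of_Ext1_kernel (F : lmodType A) (p : {linear F -> M}) :
  projective F -> (forall y, exists x, p x = y) ->
  Ext_of_vanishes 1 (kernel p) -> projective M.
Proof.
move=> F_proj p_surj /Ext_of_vanishesP EK.
have [a pa] := res_proj aug p_surj.
(* [c] is the 1-cocycle of this extension; bounding it by [k] makes the lift [a - k] of [aug] vanish
   on the kernel of [aug]. *)
have [x|c ac] := @kernel_factor _ _ _ _ p (a \o d 0).
  by rewrite /= pa res_augd.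
have [x|k ck] := EK c.
  by apply: kernel_incl_inj; rewrite -ac linear0 /= res_dd linear0.
pose b : {linear P 0 -> F} := a \- (kernel_incl p \o k).
have b0 x : aug x = 0 -> b x = 0.
  move=> /res_exact0[y <-].
  have ay : a (d 0 y) = kernel_incl p (c y) by rewrite -ac.
  by rewrite /b /= ay ck subrr.
have pb x : p (b x) = aug x.
  by rewrite /b /= linearB pa kernel_inclP subr0.
(* [b] descends to [M] through a set-theoretic section [r] of [aug]; linearity holds because [b]
   kills the kernel of [aug]. *)
have [r rE] := choice (@res_aug_surj _ _ R).
pose s x := b (r x).
have s_lin : linear s.
  move=> t x y; apply/eqP; rewrite -subr_eq0 /s -linearP -linearB.
  by apply/eqP/b0; rewrite linearB linearP !rE subrr.
pose sL : {linear M -> F} :=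
  HB.pack s (GRing.isLinear.Build A M F *:%R s s_lin).
move=> X Y q u q_surj.
have [h qh] := F_proj X Y q (u \o p) q_surj.
by exists (h \o sL) => z; rewrite [LHS]qh /= pb rE.
Qed.

(** Each coordinate of a cocycle bounds separately, and the bounding maps assemble because the index
    set is finite. *)
Lemma Ext_of_vanishes_free n m :
  Ext_of_vanishes n.+1 A^o -> Ext_of_vanishes n.+1 (free_module A 'I_m).
Proof.
move=> /Ext_of_vanishesP E; apply/Ext_of_vanishesP => f fd.
have coord_lin i : linear (fun x : free_module A 'I_m => free_val x i : A^o).
  by [].
pose coord i : {linear free_module A 'I_m -> A^o} :=
  HB.pack (fun x : free_module A 'I_m => free_val x i : A^o)
  (GRing.isLinear.Build A _ A^o *:%R _ (coord_lin i)).
have /choice[g fg] i : exists g : {linear P n -> A^o},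
    forall x, coord i (f x) = g (d n x).
  by apply: (E (coord i \o f)) => x; rewrite /= fd.
have g_supp x : (fun i => g i x) \in @fin_supp A 'I_m.
  rewrite unfold_in; apply/asboolP.
  by exists (enum 'I_m) => i; rewrite mem_enum.
pose G x := FreeModule (g_supp x).
have G_lin : linear G.
  by move=> a x y; apply: val_inj; apply/funext => i; rewrite /= linearP.
pose GL : {linear P n -> free_module A 'I_m} :=
  HB.pack G (GRing.isLinear.Build A _ _ *:%R G G_lin).
exists GL => x.
by apply: val_inj; apply/funext => i; rewrite /= -fg.
Qed.

End ExtVanishing.

(** * Free presentations and dimension shifting under (AC) *)

Lemma free_module_fg (A : pzRingType) (m : nat) :
  finitely_generated (free_module A 'I_m).
Proof.
exists m, (@delta A _) => f; exists (free_val f).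
rewrite [LHS]free_decomp -/(free_eval (@delta A _) f).
rewrite (@free_evalE _ _ _ _ f (enum 'I_m)) ?enum_uniq ?big_enum // => x.
by rewrite mem_enum.
Qed.

Lemma fg_free_presentation (A : pzRingType) (N : lmodType A) :
  finitely_generated N ->
  exists m (p : {linear free_module A 'I_m -> N}), forall y, exists x, p x = y.
Proof.
move=> [m [v vP]]; exists m, (free_eval v) => y; have [c ->] := vP y.
exists (\sum_(i < m) c i *: delta A i).
rewrite linear_sum; apply: eq_bigr => i _.
by rewrite linearZ /= free_eval_delta.
Qed.

Lemma AC_Ext_vanishes (A : pzRingType) (M N : lmodType A) :
  left_noetherian A -> condition_AC A -> finitely_generated M ->
  (forall i, (1 <= i)%N -> Ext_vanishes i M A^o) ->
  finitely_generated N -> Ext_eventually_vanishes M N ->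
  forall i, Ext_vanishes i.+1 M N.
Proof.
move=> hA hAC hM hMA hN hMN i; have [b bP] := hAC M hM.
(* [k] counts the syzygies still to be taken: each one raises the degree by one, until it exceeds
   [b]. *)
have [k] : exists k, (b < k + i.+1)%N by exists b; rewrite addnS ltnS leq_addr.
elim: k i N hN hMN => [|k IH] i N hN hMN bk; first exact: bP hMN _ bk.
have [m [p p_surj]] := fg_free_presentation hN.
have EF j : Ext_vanishes j.+1 M (free_module A 'I_m).
  exact/(@Ext_of_vanishes_free _ _ (std_resolution M))/hMA.
apply: (Ext_of_vanishes_cokernel p_surj); last exact: EF.
apply: IH; last by rewrite -addSnnS.
  by apply: noetherian_kernel_fg => //; apply: free_module_fg.
(* Passing to the kernel shifts degrees by one, hence the bound [c.+1], which also excludes degrees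
   0 and 1. *)
have [c cP] := hMN; exists c.+1 => -[|[|j]] // cj.
apply: (@Ext_of_vanishes_kernel _ _ (std_resolution M) _ _ _ p_surj).
  exact: cP.
exact: EF.
Qed.

Theorem theoremA (A : pzRingType) (M : lmodType A)
    (hA : left_noetherian A) (hAC : condition_AC A)
    (hM : finitely_generated M)
    (hMM : Ext_eventually_vanishes M M)
    (hMA : forall i : nat, (1 <= i)%N -> Ext_vanishes i M A^o) :
  projective M.
Proof.
have [m [p p_surj]] := fg_free_presentation hM.
have F_proj := @free_module_projective A 'I_m.
apply: (@projective_of_Ext1_kernel _ _ (std_resolution M) _ _ F_proj p_surj).
apply: AC_Ext_vanishes => //.
  by apply: noetherian_kernel_fg => //; apply: free_module_fg.
(* Eventual vanishing passes from [M] to its first syzygy by the same shift. *)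
have [c cP] := hMM; exists c.+1 => -[|[|j]] // cj.
apply: (@Ext_of_vanishes_kernel _ _ (std_resolution M) _ _ _ p_surj).
  exact: cP.
exact/(@Ext_of_vanishes_free _ _ (std_resolution M))/hMA.
Qed.
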